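(* Let $n\ge 3$ and $k\in\{2,\ldots,n-1\}$, and let $T^{k,n}$ be the problem instance defined in the context. Let $N^a$ be any output of Algorithm 1 on input $T^{k,n}$, i.e., a CPT such that, writing $T^{k,n}=(N_1,\ldots,N_t)$ and letting, for each $s$, $N^*_s$ be a CPT minimizing $f_{T^{k,n}}$ among all CPTs for $V_n$ whose parent set is contained in $Pa(N_s,V_n)$, we have $N^a=N^*_{s^*}$ for some $s^*$ with $f_{T^{k,n}}(N^*_{s^*})=\min_{1\le s\le t}f_{T^{k,n}}(N^*_s)$. Then $N^a$ is an optimal solution for $T^{k,n}$.
   Context: Binary attributes $V_1,\ldots,V_n$, each with domain $\{0,1\}$. For $Q\subseteq\{V_1,\ldots,V_{n-1}\}$, $\mathrm{Inst}(Q)$ is the set of assignments of values in $\{0,1\}$ to the attributes of $Q$ (contexts). A (complete) CPT $N$ for $V_n$ consists of a parent set $Pa(N,V_n)\subseteq\{V_1,\ldots,V_{n-1}\}$ and, for each $\gamma\in\mathrm{Inst}(Pa(N,V_n))$, exactly one rule, either $\gamma:0\succ 1$ or $\gamma:1\succ 0$. A swap over $V_n$ is identified with an element $x\in\{0,1\}^{n-1}$; the vote of $N$ on $x$ is $0$ if the rule of $N$ whose context agrees with $x$ on $Pa(N,V_n)$ is of the form $\gamma:0\succ1$, and $1$ otherwise. $\Delta(N,N')$ is the number of swaps on which $N,N'$ vote differently. For a problem instance $T=(N_1,\ldots,N_t)$ (tuple of CPTs for $V_n$), $f_T(N)=\sum_{s=1}^t\Delta(N,N_s)$; an optimal solution for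 $T$ is a CPT for $V_n$ (any parent set $\subseteq\{V_1,\ldots,V_{n-1}\}$) minimizing $f_T$. The instance $T^{k,n}=(N_1,\ldots,N_t)$, for $n\ge3$, $k\in\{2,\ldots,n-1\}$, has $t=\binom{n-1}{k}2^k$, with the indices $s$ in bijection with the pairs $(P,\gamma)$ where $P$ is a $k$-element subset of $\{V_1,\ldots,V_{n-1}\}$ and $\gamma\in\mathrm{Inst}(P)$; the CPT $N_s$ corresponding to $(P,\gamma)$ has parent set $P$, the rule $\gamma:1\succ0$, and the rule $\gamma':0\succ1$ for every $\gamma'\in\mathrm{Inst}(P)\setminus\{\gamma\}$. *)

(* Defs.v *)
From HB Require Import structures.
From mathcomp Require Import all_boot.

Set Implicit Arguments.
Unset Strict Implicit.
Unset Printing Implicit Defensive.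

(* The attributes V_1, ..., V_(n-1) are the elements of 'I_n.-1, and the      *)
(* domain {0,1} is bool, with false = 0 and true = 1.                         *)

Definition Inst (n : nat) (Q : {set 'I_n.-1}) : finType :=
  {ffun {i : 'I_n.-1 | i \in Q} -> bool}.

Definition swap (n : nat) : finType := {ffun 'I_n.-1 -> bool}.

(* rule N g is the preferred value of V_n in context g: false encodes the     *)
(* rule g : 0 > 1 and true the rule g : 1 > 0. A parent need not influence    *)
(* the preference.                                                            *)
Record cpt (n : nat) := CPT {
  Pa : {set 'I_n.-1};
  rule : {ffun Inst Pa -> bool}
}.

Definition restr (n : nat) (x : swap n) (Q : {set 'I_n.-1}) : Inst Q :=
  [ffun i : {i : 'I_n.-1 | i \in Q} => x (val i)].

Definition vote (n : nat) (N : cpt n) (x : swap n) : bool :=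
  rule N (restr x (Pa N)).

Definition Delta (n : nat) (N N' : cpt n) : nat :=
  #|[set x : swap n | vote N x != vote N' x]|.

Definition cost (n t : nat) (T : t.-tuple (cpt n)) (N : cpt n) : nat :=
  \sum_(s < t) Delta N (tnth T s).

Definition optimal (n t : nat) (T : t.-tuple (cpt n)) (N : cpt n) : Prop :=
  forall N' : cpt n, cost T N <= cost T N'.

Definition optimal_within (n t : nat) (T : t.-tuple (cpt n))
    (Q : {set 'I_n.-1}) (N : cpt n) : Prop :=
  Pa N \subset Q /\
  forall N' : cpt n, Pa N' \subset Q -> cost T N <= cost T N'.

(* The choice of the restricted minimizers Nstar s and of the index sstar is  *)
(* left free, so that every way of breaking ties is covered.                  *)
Definition algorithm_output (n t : nat) (T : t.-tuple (cpt n))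
    (Na : cpt n) : Prop :=
  exists Nstar : 'I_t -> cpt n,
    (forall s : 'I_t, optimal_within T (Pa (tnth T s)) (Nstar s)) /\
    exists sstar : 'I_t,
      (forall s : 'I_t, cost T (Nstar sstar) <= cost T (Nstar s)) /\
      Na = Nstar sstar.

(* The pairs (P, g) with #|P| = k and g in Inst P.                            *)
Definition kcontext (k n : nat) : finType :=
  {p : {P : {set 'I_n.-1} & Inst P} | #|tag p| == k}.

Definition cpt_of_kcontext (k n : nat) (p : kcontext k n) : cpt n :=
  CPT [ffun g : Inst (tag (val p)) => g == tagged (val p)].

(* Tkn e is the instance T^{k,n} listed in the order given by e, which is     *)
(* meant to be a bijection; card_kcontext shows that one exists.              *)
Definition Tkn (k n : nat)
    (e : 'I_('C(n.-1, k) * 2 ^ k) -> kcontext k n) :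
    ('C(n.-1, k) * 2 ^ k).-tuple (cpt n) :=
  [tuple cpt_of_kcontext (e s) | s < 'C(n.-1, k) * 2 ^ k].

Lemma card_kcontext (k n : nat) : #|kcontext k n| = 'C(n.-1, k) * 2 ^ k.
Proof.
rewrite card_sig -sum1_card.
pose U (P : {set 'I_n.-1}) (_ : Inst P) := 1.
rewrite (eq_bigr (fun p => U (tag p) (tagged p))) //.
rewrite (eq_bigl (fun p : {P : {set 'I_n.-1} & Inst P} =>
  (#|tag p| == k) && true)); last by move=> p; rewrite andbT.
rewrite -(sig_big_dep (fun P : {set 'I_n.-1} => #|P| == k) (fun _ _ => true) U).
rewrite (eq_bigr (fun=> 2 ^ k)) => [|P /eqP cardP]; last first.
  by rewrite sum1_card card_ffun card_bool card_sig cardP.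
by rewrite sum_nat_const -[X in 'C(X, _)]card_ord -card_draws cardsE.
Qed.

(* Main.v *)
Require Import Defs.
From mathcomp Require Import all_boot.

(* The cost counts disagreements swap by swap, so a CPT that on every swap    *)
(* disagrees with at most half of the voters is optimal. For each k-set P,    *)
(* exactly one context of P agrees with a given swap x; so on x only          *)
(* 'C(n.-1, k) of the 'C(n.-1, k) * 2 ^ k voters vote 1, and the constant CPT *)
(* voting 0 is optimal. It has no parents, hence it competes in each          *)
(* restricted minimization, and the output of the algorithm costs no more.    *)

Set Implicit Arguments.
Unset Strict Implicit.
Unset Printing Implicit Defensive.

Section Instance.

Variables (n t : nat) (T : t.-tuple (cpt n)).
Implicit Types (N : cpt n) (x : swap n).

Definition dissenters N x : {set 'I_t} :=
  [set s | vote N x != vote (tnth T s) x].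

Lemma cost_dissenters N : cost T N = \sum_x #|dissenters N x|.
Proof.
rewrite /cost /Delta; under eq_bigr do rewrite -sum1dep_card.
rewrite (exchange_big_dep xpredT) //=.
by apply: eq_bigr => x _; rewrite sum1dep_card.
Qed.

Lemma eq_dissenters N N' x :
  vote N x = vote N' x -> dissenters N x = dissenters N' x.
Proof. by rewrite /dissenters => ->. Qed.

Lemma dissentersC N N' x :
  vote N x != vote N' x -> dissenters N' x = ~: dissenters N x.
Proof.
by move=> neqN; apply/setP => s; rewrite !inE; move: neqN; do 3!case: (vote _ x).
Qed.

Lemma majority_optimal N :
  (forall x, #|dissenters N x|.*2 <= t) -> optimal T N.
Proof.
move=> majN N'; rewrite !cost_dissenters; apply: leq_sum => x _.
have [/eq_dissenters -> // | /dissentersC ->] := eqVneq (vote N x) (vote N' x).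
by rewrite -(leq_add2l #|dissenters N x|) cardsC card_ord addnn.
Qed.

Lemma algorithm_output_le Na N (s : 'I_t) :
  algorithm_output T Na -> Pa N \subset Pa (tnth T s) -> cost T Na <= cost T N.
Proof.
move=> [Nstar [optNstar [sstar [min_sstar ->]]]] sub_s.
exact: leq_trans (min_sstar s) ((optNstar s).2 N sub_s).
Qed.

Lemma algorithm_output_optimal Na N (s : 'I_t) :
    algorithm_output T Na -> Pa N \subset Pa (tnth T s) -> optimal T N ->
  optimal T Na.
Proof.
move=> outNa sub_s optN N'.
exact: leq_trans (algorithm_output_le outNa sub_s) (optN N').
Qed.

End Instance.

Definition const_cpt (n : nat) (b : bool) : cpt n :=
  CPT [ffun _ : Inst (set0 : {set 'I_n.-1}) => b].

Lemma vote_const_cpt (n : nat) (b : bool) (x : swap n) :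
  vote (const_cpt n b) x = b.
Proof. by rewrite /vote ffunE. Qed.

Lemma vote_kcontext (k n : nat) (p : kcontext k n) (x : swap n) :
  vote (cpt_of_kcontext p) x = (tagged (val p) == restr x (tag (val p))).
Proof. by rewrite /vote ffunE eq_sym. Qed.

Definition kvoters (k n : nat) (x : swap n) : {set kcontext k n} :=
  [set p | vote (cpt_of_kcontext p) x].

Lemma card_kvoters (k n : nat) (x : swap n) : #|kvoters k x| = 'C(n.-1, k).
Proof.
have tag_inj : {in kvoters k x &, injective (fun p => tag (val p))}.
  move=> [[P g] Pk] [[P' g'] Pk']; rewrite !inE !vote_kcontext /=.
  by move=> /eqP gE /eqP g'E eqP'; apply: val_inj; rewrite /= gE g'E eqP'.
rewrite -(card_in_imset tag_inj) -[in RHS](card_ord n.-1) -card_draws.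
apply: eq_card => P; rewrite inE; apply/imsetP/idP => [[p _ ->] | Pk].
  exact: valP p.
exists (Sub (Tagged (fun P => Inst P) (restr x P)) Pk) => //.
by rewrite inE vote_kcontext.
Qed.

Lemma dissenters_const0 (n k : nat)
    (e : 'I_('C(n.-1, k) * 2 ^ k) -> kcontext k n) (x : swap n) :
  dissenters (Tkn e) (const_cpt n false) x = e @^-1: kvoters k x.
Proof.
by apply/setP => s; rewrite !inE vote_const_cpt tnth_mktuple; case: vote.
Qed.

Lemma const0_optimal (n k : nat)
    (e : 'I_('C(n.-1, k) * 2 ^ k) -> kcontext k n) :
  0 < k -> bijective e -> optimal (Tkn e) (const_cpt n false).
Proof.
move=> k_gt0 bij_e; apply: majority_optimal => x.
rewrite dissenters_const0 (on_card_preimset (onW_bij _ bij_e)) card_kvoters.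
by rewrite -muln2 leq_mul // -[leqLHS]expn1 leq_exp2l.
Qed.

Theorem theorem16 (n k : nat) (hn : 3 <= n) (hk : 2 <= k <= n.-1)
    (e : 'I_('C(n.-1, k) * 2 ^ k) -> kcontext k n) (he : bijective e)
    (Na : cpt n) (hNa : algorithm_output (Tkn e) Na) :
  optimal (Tkn e) Na.
Proof.
have k_gt0 : 0 < k by case/andP: hk => /ltnW.
have [_ [_ [s _]]] := hNa.
have no_parents : Pa (const_cpt n false) \subset Pa (tnth (Tkn e) s).
  exact: sub0set.
exact: algorithm_output_optimal hNa no_parents (const0_optimal k_gt0 he).
Qed.
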